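(* Let $I$ be a non-empty finite set and let $X=(X_i)_{i\in I}$ be a simple max-stable random vector with positive continuous density. Then, for any disjoint non-empty subsets $A$ and $B$ of $I$, if $X_A$ and $X_B$ are conditionally independent given $X_{I\setminus(A\cup B)}$, then $X_A$ and $X_B$ are independent.
   Context: A random vector $X=(X_i)_{i\in I}$ (with $I$ a non-empty finite set) is called simple max-stable if each component is standard Fréchet distributed, i.e. $\mathbb{P}(X_i\le x)=\exp(-1/x)$ for $x\in(0,\infty)$, and for every $n\ge 1$ the vector $nX$ has the same distribution as the componentwise maximum $\max(X^{(1)},\dots,X^{(n)})$ of $n$ independent copies $X^{(1)},\dots,X^{(n)}$ of $X$. ''$X$ has a positive continuous density'' means that the joint distribution of the components of $X$ has a density with respect to Lebesgue measure on $(0,\infty)^I$ that is positive and continuous on $(0,\infty)^I$. For $A\subset I$, $X_A$ denotes the subvector $(X_i)_{i\in A}$. Random variables $Y_1,\dots,Y_k$ (with values in arbitrary measurable spaces) on a probability space $(\Omega,\mathcal{A},\mathbb{P})$ are conditionally independent given a random variable $Z$ on the same space if $\mathbb{P}(Y_1\in A_1,\dots,Y_k\in A_k\mid Z)=\prod_{i=1}^k\mathbb{P}(Y_i\in A_i\mid Z)$ $\mathbb{P}$-a.s. for all measurable sets $A_1,\dots,A_k$ of the respective state spaces, where conditioning is with respect to the $\sigma$-algebra generated by $Z$ (the trivial $\sigma$-algebra if $Z$ is the empty vector). *)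

(* Defs.v *)
From HB Require Import structures.
From mathcomp Require Import all_boot all_order all_algebra.
From mathcomp Require Import all_classical all_reals all_analysis.

Set Implicit Arguments.
Unset Strict Implicit.
Unset Printing Implicit Defensive.

Import Order.TTheory GRing.Theory Num.Theory.
Import numFieldNormedType.Exports.

Local Open Scope classical_set_scope.
Local Open Scope ring_scope.

(* R^J with the product topology and the product (= Borel, J being finite)
   sigma-algebra. If J is empty this is a single point. *)
Definition vec (R : realType) (J : finType) : Type := {ptws J -> R}.

HB.instance Definition _ (R : realType) (J : finType) :=
  Uniform.copy (vec R J) {ptws J -> R}.
HB.instance Definition _ (R : realType) (J : finType) :=
  isPointed.Build (vec R J) (fun=> 0).

Section vec_measurable.
Context (R : realType) (J : finType).

Definition vec_measurable : set (set (vec R J)) :=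
  <<s \bigcup_(j in [set: J])
        preimage_set_system [set: vec R J] (fun x => x j) (@measurable _ R) >>.

Let vec_measurable0 : vec_measurable set0.
Proof. exact: sigma_algebra0. Qed.

Let vec_measurableC A : vec_measurable A -> vec_measurable (~` A).
Proof. exact: sigma_algebraC. Qed.

Let vec_measurable_bigcup (F : (set (vec R J))^nat) :
  (forall i, vec_measurable (F i)) -> vec_measurable (\bigcup_i (F i)).
Proof. exact: sigma_algebra_bigcup. Qed.

HB.instance Definition _ := @isMeasurable.Build default_measure_display
  (vec R J) vec_measurable vec_measurable0 vec_measurableC
  vec_measurable_bigcup.

Lemma measurable_coord (j : J) :
  measurable_fun [set: vec R J] (fun x : vec R J => x j).
Proof.
by move=> _ Y mY; apply: sub_sigma_algebra; exists j => //; exists Y.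
Qed.

Lemma measurable_vecP d (T : measurableType d) (f : T -> vec R J) :
  measurable_fun [set: T] f <->
  forall j, measurable_fun [set: T] (fun w => f w j).
Proof.
split=> [mf j|mf]; first exact: (measurableT_comp (measurable_coord j) mf).
move=> _.
have mfT : measurable_fun [set: T]
    (f : T -> g_sigma_algebraType (\bigcup_(j in [set: J])
        preimage_set_system [set: vec R J] (fun x => x j) (@measurable _ R))).
  apply: (@measurability _ _ _ _ _ _ (\bigcup_(j in [set: J])
        preimage_set_system [set: vec R J] (fun x => x j) (@measurable _ R))) => //.
  move=> _ [_ [j _ [Y mY <-]] <-].
  by rewrite !setTI; have := mf j measurableT Y mY; rewrite setTI.
exact: mfT.
Qed.

End vec_measurable.

Definition subvec (R : realType) (I : finType) (A : {set I}) (x : vec R I) :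
  vec R {i : I | i \in A} := fun i => x (val i).
Arguments subvec {R I} A x.

Lemma measurable_subvec (R : realType) (I : finType) (A : {set I}) :
  measurable_fun [set: vec R I] (@subvec R I A).
Proof. by apply/measurable_vecP => j; exact: measurable_coord. Qed.

(* pushforward is only a measure given a measurability proof, which inference
   cannot find; with f bundled the measure structure becomes canonical. *)
Section mpushforward.
Context d d' (T : measurableType d) (T' : measurableType d') (R : realType).
Context (m : {measure set T -> \bar R}) (f : {mfun T >-> T'}).

Definition mpushforward : set T' -> \bar R := pushforward m f.

Let mpushforward0 : mpushforward set0 = 0%E.
Proof. exact: measure0. Qed.

Let mpushforward_ge0 A : (0 <= mpushforward A)%E.
Proof. exact: measure_ge0. Qed.

Let mpushforward_sigma_additive : semi_sigma_additive mpushforward.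
Proof.
move=> F mF tF mUF; rewrite /mpushforward /pushforward preimage_bigcup.
apply: measure_semi_sigma_additive.
- by move=> n; exact: measurable_funPTI.
- by move=> i j Di Dj [w [Fi Fj]]; apply: tF => //; exists (f w).
- by rewrite -preimage_bigcup; exact: measurable_funPTI.
Qed.

HB.instance Definition _ := isMeasure.Build _ _ _ mpushforward
  mpushforward0 mpushforward_ge0 mpushforward_sigma_additive.

End mpushforward.

Lemma sigma_finite_product d1 d2 (T1 : measurableType d1)
    (T2 : measurableType d2) (R : realType)
    (m1 : {sigma_finite_measure set T1 -> \bar R})
    (m2 : {sigma_finite_measure set T2 -> \bar R}) :
  sigma_finite setT (m1 \x m2)%E.
Proof.
have /sigma_finiteP[F [TF ndF Foo]] := sigma_finiteT m1.
have /sigma_finiteP[G [TG ndG Goo]] := sigma_finiteT m2.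
exists (fun n => F n `*` G n).
  rewrite -setXTT TF TG predeqE => -[x y]; split.
    move=> [/= [n _ Fnx] [k _ Gky]]; exists (maxn n k) => //; split.
    - by move: x Fnx; exact/subsetPset/ndF/leq_maxl.
    - by move: y Gky; exact/subsetPset/ndG/leq_maxr.
  by move=> [n _ []/= ? ?]; split; exists n.
move=> k; have [mF Fk] := Foo k; have [mG Gk] := Goo k.
split; first exact: measurableX.
by rewrite product_measure1E// lte_mul_pinfty// ge0_fin_numE.
Qed.

Section lebesgue_vec.
Context (R : realType).
Local Notation M := (measurableTypeR R).

Definition tcons n (p : M * n.-tuple M) : n.+1.-tuple M := [tuple of p.1 :: p.2].

Let measurable_tcons n : measurable_fun [set: M * n.-tuple M] (@tcons n).
Proof. exact: measurable_cons. Qed.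

HB.instance Definition _ n :=
  isMeasurableFun.Build _ _ _ _ (@tcons n) (@measurable_tcons n).

Section step.
Context (n : nat) (m : {sigma_finite_measure set (n.-tuple M) -> \bar R}).

Definition lebesgue_tuple_step : set (n.+1.-tuple M) -> \bar R :=
  mpushforward (@lebesgue_measure R \x m)%E (@tcons n).

HB.instance Definition _ := Measure.on lebesgue_tuple_step.

Let lebesgue_tuple_step_sigma_finite : sigma_finite setT lebesgue_tuple_step.
Proof.
have [F FT Foo] := sigma_finite_product (@lebesgue_measure R) m.
pose g (t : n.+1.-tuple M) : M * n.-tuple M := (thead t, [tuple of behead t]).
have mg : measurable_fun [set: n.+1.-tuple M] g.
  apply: measurable_fun_pair; first exact: measurable_tnth.
  exact: measurable_behead.
have tgK : cancel (@tcons n) g.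
  by case=> x t; congr pair; apply/val_inj.
exists (fun k => g @^-1` (F k)).
  by rewrite -preimage_bigcup -FT preimage_setT.
move=> k; have [mF Fk] := Foo k; split.
  by rewrite -[X in measurable X]setTI; exact: mg.
rewrite /lebesgue_tuple_step /mpushforward /pushforward/= -comp_preimage.
by rewrite (_ : g \o _ = id)//; apply/funext => x /=; rewrite tgK.
Qed.

HB.instance Definition _ := Measure_isSigmaFinite.Build _ _ _
  lebesgue_tuple_step lebesgue_tuple_step_sigma_finite.

End step.

Fixpoint lebesgue_tuple n : {sigma_finite_measure set (n.-tuple M) -> \bar R} :=
  if n is k.+1 then lebesgue_tuple_step (lebesgue_tuple k)
  else \d_[tuple].

Context (J : finType).

Definition vec_of_tuple (t : #|J|.-tuple M) : vec R J :=
  fun j => tnth t (enum_rank j).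

Let measurable_vec_of_tuple :
  measurable_fun [set: #|J|.-tuple M] vec_of_tuple.
Proof. by apply/measurable_vecP => j; exact: measurable_tnth. Qed.

HB.instance Definition _ :=
  isMeasurableFun.Build _ _ _ _ vec_of_tuple measurable_vec_of_tuple.

Definition lebesgue_vec : set (vec R J) -> \bar R :=
  mpushforward (lebesgue_tuple #|J|) vec_of_tuple.

HB.instance Definition _ := Measure.on lebesgue_vec.

End lebesgue_vec.

Section lebesgue_box.
Context (R : realType).
Local Notation M := (measurableTypeR R).

Lemma lebesgue_tuple_box n (A : 'I_n -> set M) :
  (forall i, measurable (A i)) ->
  lebesgue_tuple R n [set t | forall i, A i (tnth t i)] =
  (\prod_(i < n) lebesgue_measure (A i))%E.
Proof.
elim: n A => [|n IHn] A mA /=.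
  rewrite big_ord0 diracE mem_set//= => -[].
  by [].
rewrite big_ord_recl -IHn; last by move=> i; exact: mA.
rewrite /lebesgue_tuple_step /mpushforward /pushforward -product_measure1E//.
  congr (_ _); apply/seteqP; split=> -[x t]/=.
    move=> At; split; first exact: (At ord0).
    by move=> i; have := At (lift ord0 i); rewrite tnthS.
  move=> [Ax At] i; case: (unliftP ord0 i) => [j ->|->]; last exact: Ax.
  by rewrite tnthS.
rewrite (_ : [set _ | _] =
    \bigcap_(i in [set: 'I_n]) (fun t : n.-tuple M => tnth t i) @^-1`
      A (lift ord0 i)).
  apply: fin_bigcap_measurable => // i _.
  by rewrite -[X in measurable X]setTI; exact: measurable_tnth.
by apply/seteqP; split=> t /= At i; [move=> _|]; exact: At.
Qed.

Lemma lebesgue_vec_box (J : finType) (A : J -> set M) :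
  (forall j, measurable (A j)) ->
  @lebesgue_vec R J [set x | forall j, A j (x j)] =
  (\prod_(j : J) lebesgue_measure (A j))%E.
Proof.
move=> mA; rewrite [RHS](reindex (@enum_val J predT))/=; last first.
  by exists enum_rank => j _; rewrite ?enum_valK ?enum_rankK.
rewrite -lebesgue_tuple_box; last by move=> i; exact: mA.
rewrite /lebesgue_vec /mpushforward /pushforward; congr (_ _).
apply/seteqP; split=> t /= At i; rewrite /vec_of_tuple.
  by have := At (enum_val i); rewrite /vec_of_tuple enum_valK.
by have := At (enum_rank i); rewrite enum_rankK.
Qed.

End lebesgue_box.

Section independence.
Context d (T : measurableType d) (R : realType) (P : probability T R).

Definition independent d1 d2 (S1 : measurableType d1) (S2 : measurableType d2)
    (Y1 : T -> S1) (Y2 : T -> S2) :=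
  forall (E1 : set S1) (E2 : set S2), measurable E1 -> measurable E2 ->
    P (Y1 @^-1` E1 `&` Y2 @^-1` E2) = (P (Y1 @^-1` E1) * P (Y2 @^-1` E2))%E.

(* Some of the E k may be the whole space, so this covers all subfamilies. *)
Definition mutually_independent d' (S : measurableType d') (K : finType)
    (Y : K -> T -> S) :=
  forall E : K -> set S, (forall k, measurable (E k)) ->
    P (\bigcap_(k in [set: K]) Y k @^-1` E k) =
    (\prod_(k : K) P (Y k @^-1` E k))%E.

(* The domain of g is annotated because the sigma-algebra generated by Z lives
   on an alias of T, which inference would resolve to T itself. *)
Definition is_cond_prob d' (S : measurableType d') (Z : T -> S)
    (E : set T) (g : T -> R) :=
  [/\ @measurable_fun _ _ (g_sigma_algebra_preimageType Z) R [set: T] g,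
      P.-integrable [set: T] (EFin \o g) &
      forall D, g_sigma_algebra_preimage Z D ->
        (\int[P]_(w in D) (g w)%:E)%E = P (E `&` D)].

(* Conditional probabilities exist and are unique up to P-null sets, so the
   identity is required of arbitrary versions. *)
Definition cond_independent d1 d2 d3 (S1 : measurableType d1)
    (S2 : measurableType d2) (S3 : measurableType d3)
    (Y1 : T -> S1) (Y2 : T -> S2) (Z : T -> S3) :=
  forall (E1 : set S1) (E2 : set S2), measurable E1 -> measurable E2 ->
  forall g g1 g2 : T -> R,
    is_cond_prob Z (Y1 @^-1` E1 `&` Y2 @^-1` E2) g ->
    is_cond_prob Z (Y1 @^-1` E1) g1 ->
    is_cond_prob Z (Y2 @^-1` E2) g2 ->
    {ae P, forall w, g w = g1 w * g2 w}.

End independence.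

Definition same_law d1 d2 d' (T1 : measurableType d1) (T2 : measurableType d2)
    (S : measurableType d') (R : realType) (P1 : probability T1 R)
    (P2 : probability T2 R) (Y1 : T1 -> S) (Y2 : T2 -> S) :=
  forall E : set S, measurable E -> P1 (Y1 @^-1` E) = P2 (Y2 @^-1` E).

Section max_stable.
Context d (T : measurableType d) (R : realType) (P : probability T R).
Context (I : finType) (X : {RV P >-> vec R I}).

Definition standard_frechet (i : I) :=
  forall x : R, 0 < x -> P [set w | X w i <= x] = (expR (- (1 / x)))%:E.

(* T need not carry n.+1 independent copies of X, so they live on some other
   probability space; their joint law, hence that of the maximum, does not
   depend on this choice. *)
Definition simple_max_stable :=
  (forall i, standard_frechet i) /\
  forall n : nat, exists (d' : measure_display) (T' : measurableType d')
      (P' : probability T' R) (Y : 'I_n.+1 -> {RV P' >-> vec R I}),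
    [/\ forall k, same_law P' P (Y k) X,
        mutually_independent P' (fun k w => Y k w) &
        same_law P P' (fun w => (fun i => n.+1%:R * X w i) : vec R I)
          (fun w => (fun i => \big[Num.max/Y ord0 w i]_(k < n.+1) Y k w i)
                    : vec R I)].

Definition posvec : set (vec R I) := [set x | forall i, 0 < x i].

(* As P (X in E) only charges E `&` posvec, X is almost surely positive. *)
Definition positive_continuous_density :=
  exists f : vec R I -> R,
    [/\ forall x, posvec x -> 0 < f x,
        {within posvec, continuous f} &
        forall E : set (vec R I), measurable E ->
          P (X @^-1` E) =
          (\int[@lebesgue_vec R I]_(x in E `&` posvec) (f x)%:E)%E].

End max_stable.

(* Main.v *)
Require Import Defs.
From HB Require Import structures.
From mathcomp Require Import all_boot all_order all_algebra.
From mathcomp Require Import all_classical all_reals all_analysis.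
From mathcomp Require Import measurable_realfun ring lra.

(* Let F_J(a) = P (X_i <= a_i for i in J) and C be the complement of A and B.
   By max-stability, F_J(a / N) = F_J(a)^N. Fix n, put N = n + 1 and let L be
   the law of X_C / N on the event X_{A, B} <= a, X_C > a (of probability
   q > 0, as X has a positive density). Realise N X as a maximum of N copies,
   one of which is in this event while the others are below a: for J = 0, A, B
   and A u B, the measure P (N X_J <= a, X_C in D) dominates
   F_(J u C)(a)^n L(D). The conditional independence of the events N X_A <= a
   and N X_B <= a given X_C is the identity h_AB * 1 = h_A * h_B between the
   densities of these measures with respect to the law of X_C, so that the
   Cauchy-Schwarz inequality applied to the square root of either side gives
     (F_(A u B u C)(a) F_C(a))^n q^2 <= (F_A(a) F_B(a))^N,
     (F_(A u C)(a) F_(B u C)(a))^n q^2 <= F_(A u B)(a)^N.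
   Letting n and then a on C tend to infinity yields
   F_(A u B) = F_A F_B. *)

Set Implicit Arguments.
Unset Strict Implicit.
Unset Printing Implicit Defensive.

Import Order.TTheory GRing.Theory Num.Theory.
Import numFieldNormedType.Exports.

Local Open Scope classical_set_scope.
Local Open Scope ring_scope.

(** * Two elementary inequalities for real numbers *)

(** This is the discriminant bound for a quadratic in [t]. As [k] is non-negative, the minimiser
    [k / r] lies in the range of admissible [t]. *)
Lemma le_sqr_of_quadratic_ge0 (R : realFieldType) (r s k : R) : 0 <= r ->
  (forall t, 0 <= t -> 2 * t * k <= t ^+ 2 * r + s) -> 0 <= k ->
  k ^+ 2 <= r * s.
Proof.
move=> r0 qge0 k0; have s0 : 0 <= s by have := qge0 0 (lexx _); lra.
have [r_eq0|r_neq0] := eqVneq r 0; last first.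
  have rgt0 : 0 < r by rewrite lt0r r_neq0.
  have := qge0 (k / r) (divr_ge0 k0 r0).
  have -> : 2 * (k / r) * k = 2 * (k ^+ 2 / r) by field.
  have -> : (k / r) ^+ 2 * r = k ^+ 2 / r by field.
  move=> H; have : k ^+ 2 / r <= s by lra.
  by rewrite ler_pdivrMr// mulrC.
rewrite r_eq0 mul0r; have [->|k_neq0] := eqVneq k 0; first by rewrite expr0n.
have kgt0 : 0 < k by rewrite lt0r k_neq0.
(* For [r = 0] the bound is linear in [t]; this [t] turns it into [2 * (s + 1) <= s], which
   contradicts [0 <= s]. *)
have := qge0 ((s + 1) / k) (divr_ge0 (addr_ge0 s0 ler01) k0).
have -> : 2 * ((s + 1) / k) * k = 2 * (s + 1) by field.
by rewrite r_eq0 => H; exfalso; move: H; lra.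
Qed.

(** If [b < a], division by [b ^+ n] bounds [(a / b) ^+ n * q] by [b] for all [n], against
    Bernoulli's inequality. *)
Lemma le_of_geometric_bound (R : realType) (a b q : R) :
  0 < q -> 0 <= b -> (forall n, a ^+ n * q <= b ^+ n.+1) -> a <= b.
Proof.
move=> q0 b0 H; rewrite leNgt; apply/negP => ba.
have a0 : 0 < a by exact: le_lt_trans ba.
(* The case [n = 0] reads [q <= b], so [b] cannot vanish. *)
have b_neq0 : b != 0.
  apply/eqP => bE; have := H 0%N.
  by rewrite expr0 mul1r expr1 bE leNgt q0.
have bgt0 : 0 < b by rewrite lt0r b_neq0.
have r1 : 0 < a / b - 1 by rewrite subr_gt0 ltr_pdivlMr// mul1r.
have Hn n : n%:R * (a / b - 1) * q <= b.
  have : (a / b) ^+ n * q <= b.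
    by rewrite expr_div_n mulrAC ler_pdivrMr ?exprn_gt0// -exprS.
  apply: le_trans; rewrite ler_wpM2r ?ltW//.
  have : 1 + n%:R * (a / b - 1) <= (1 + (a / b - 1)) ^+ n.
    elim: n => [|n IH]; first by rewrite mul0r addr0 expr0.
    rewrite exprS (le_trans _ (ler_wpM2l _ IH))//; last by lra.
    have : 0 <= n%:R * (a / b - 1) * (a / b - 1) :> R.
      by rewrite !mulr_ge0// ltW.
    rewrite -natr1; lra.
  by rewrite subrKC; lra.
have rq : 0 < (a / b - 1) * q by rewrite mulr_gt0.
have := Hn (Num.truncn (b / ((a / b - 1) * q))).+1.
rewrite -mulrA -ler_pdivlMr// leNgt.
by rewrite truncnS_gt.
Qed.

(** * Comparison of densities and a Cauchy-Schwarz bound *)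

Section measure_densities.
Local Open Scope ereal_scope.
Context d (T : measurableType d) (R : realType).

(** Take for [D] the set where [g < f]: there [f - g] is positive but its integral is at most 0, so
    the set is null. *)
Lemma ae_le_of_integral_le (mu : {measure set T -> \bar R}) (f g : T -> R) :
  mu.-integrable [set: T] (EFin \o f) -> mu.-integrable [set: T] (EFin \o g) ->
  (forall D, measurable D ->
    \int[mu]_(x in D) (f x)%:E <= \int[mu]_(x in D) (g x)%:E) ->
  {ae mu, forall x, (f x <= g x)%R}.
Proof.
move=> fi gi fg.
have mf : measurable_fun [set: T] f by exact/measurable_EFinP/measurable_int/fi.
have mg : measurable_fun [set: T] g by exact/measurable_EFinP/measurable_int/gi.
pose N := [set x | (g x < f x)%R].
have mN : measurable N by rewrite -[N]setTI; exact: measurable_fun_ltr.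
have mfg : measurable_fun N (fun x => (f x - g x)%:E).
  by apply/measurable_EFinP/measurable_funB; exact: measurable_funTS.
have int0 : \int[mu]_(x in N) (f x - g x)%:E = 0.
  apply/eqP; rewrite eq_le; apply/andP; split; last first.
    by apply: integral_ge0 => x Nx; rewrite lee_fin subr_ge0 ltW.
  have fiN := integrableS measurableT mN (subsetT _) fi.
  have giN := integrableS measurableT mN (subsetT _) gi.
  under eq_integral do rewrite EFinB.
  rewrite integralB_EFin// leeBlDr; last exact: integrable_fin_num.
  by rewrite add0e fg.
exists N; split => //; last by move=> x /= /negP; rewrite -ltNge.
have : ae_eq mu N (fun x => (f x - g x)%:E) (cst 0).
  apply/(ae_eq_integral_abs mu mN mfg); rewrite -[RHS]int0.
  apply: eq_integral => x; rewrite inE => Nx.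
  by rewrite gee0_abs// lee_fin subr_ge0 ltW.
case=> M [mM M0 NM]; apply/eqP; rewrite eq_le measure_ge0 andbT -M0.
apply: le_measure; rewrite ?inE// => x Nx; apply: NM => /(_ Nx)/eqP.
by rewrite eqe subr_eq0 gt_eqF.
Qed.

(** A version of the Radon-Nikodym derivative that is real-valued and non-negative everywhere, so
    that densities can be multiplied pointwise in [R]. *)
Lemma density_exists (mu : {sigma_finite_measure set T -> \bar R})
    (nu : {finite_measure set T -> \bar R}) : nu `<< mu ->
  exists h : T -> R, [/\ (forall x, 0 <= h x)%R,
    mu.-integrable [set: T] (EFin \o h) &
    forall D, measurable D -> \int[mu]_(x in D) (h x)%:E = nu D].
Proof.
move=> /radon_nikodym_sigma_finite[f [f0 ffin fi fE]].
exists (fine \o f); split=> [x||D mD].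
- exact: fine_ge0.
- by rewrite (_ : _ \o _ = f)//; apply/funext => x /=; rewrite fineK.
- by rewrite fE//; apply: eq_integral => x _ /=; rewrite fineK.
Qed.

(* Cauchy-Schwarz for [sqrt (r * s) = sqrt (p * q) >= sqrt (a * b) * l],
   in the linearised form [2 t sqrt (a * b) l <= t ^ 2 r + s]. *)
Lemma integral_sqr_le_of_product_eq (mu : {measure set T -> \bar R})
    (p q r s l : T -> R) (a b rI sI lI : R) :
  measurable_fun [set: T] r -> measurable_fun [set: T] s ->
  measurable_fun [set: T] l ->
  (forall x, 0 <= r x)%R -> (forall x, 0 <= s x)%R -> (forall x, 0 <= l x)%R ->
  (0 <= a)%R -> (0 <= b)%R ->
  {ae mu, forall x, (p x * q x = r x * s x)%R} ->
  {ae mu, forall x, (a * l x <= p x)%R} ->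
  {ae mu, forall x, (b * l x <= q x)%R} ->
  \int[mu]_x (r x)%:E = rI%:E -> \int[mu]_x (s x)%:E = sI%:E ->
  \int[mu]_x (l x)%:E = lI%:E ->
  (a * b * lI ^+ 2 <= rI * sI)%R.
Proof.
move=> mr ms ml r0 s0 l0 a0 b0 pqrs alp blq rIE sIE lIE.
have rI0 : (0 <= rI)%R.
  by rewrite -lee_fin -rIE integral_ge0 => // x _; rewrite lee_fin.
have lI0 : (0 <= lI)%R.
  by rewrite -lee_fin -lIE integral_ge0 => // x _; rewrite lee_fin.
have ab0 : (0 <= a * b)%R by rewrite mulr_ge0.
pose k := Num.sqrt (a * b); have k0 : (0 <= k)%R by exact: sqrtr_ge0.
have k2 : (k ^+ 2 = a * b)%R by rewrite sqr_sqrtr.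
rewrite -k2 -exprMn; apply: (le_sqr_of_quadratic_ge0 rI0 _ (mulr_ge0 k0 lI0)).
move=> t t0; rewrite -lee_fin.
rewrite [leLHS](_ : _ = \int[mu]_x (2 * t * k * l x)%:E); last first.
  under eq_integral do rewrite EFinM.
  rewrite ge0_integralZl//=; last 3 first.
  - exact/measurable_EFinP.
  - by move=> x _; rewrite lee_fin.
  - by rewrite lee_fin !mulr_ge0.
  by rewrite lIE -EFinM mulrA.
rewrite [leRHS](_ : _ = \int[mu]_x (t ^+ 2 * r x + s x)%:E); last first.
  under eq_integral do rewrite EFinD EFinM.
  rewrite ge0_integralD//=; last 4 first.
  - by move=> x _; rewrite -EFinM lee_fin mulr_ge0 ?sqr_ge0.
  - by apply/measurable_EFinP; exact: measurable_funM.
  - by move=> x _; rewrite lee_fin.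
  - exact/measurable_EFinP.
  rewrite ge0_integralZl//=; last 3 first.
  - exact/measurable_EFinP.
  - by move=> x _; rewrite lee_fin.
  - by rewrite lee_fin sqr_ge0.
  by rewrite rIE sIE.
apply: ae_ge0_le_integral => //.
- by move=> x _; rewrite lee_fin !mulr_ge0.
- by apply/measurable_EFinP; exact: measurable_funM.
- by move=> x _; rewrite lee_fin addr_ge0// mulr_ge0// sqr_ge0.
- by apply/measurable_EFinP/measurable_funD => //; exact: measurable_funM.
apply: filterS3 pqrs alp blq => x pqrsx alpx blqx _; rewrite lee_fin.
have : ((k * l x) ^+ 2 <= r x * s x)%R.
  rewrite -pqrsx exprMn k2 expr2 mulrACA.
  by apply: ler_pM => //; exact: mulr_ge0.
have := mulr_ge0 k0 (l0 x); move: (r0 x) (s0 x) t0.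
move: (k * l x)%R (r x) (s x) (mulrA (2 * t)%R k (l x)).
move=> y u v <- u0 v0 t0 y0 yuv.
(* The arithmetic-geometric mean inequality for [t ^+ 2 * u] and [v], in squared form to avoid the
   root of [u * v]. *)
have : ((2 * t * y) ^+ 2 <= (t ^+ 2 * u + v) ^+ 2)%R.
  have := sqr_ge0 (t ^+ 2 * u - v)%R.
  have : (t ^+ 2 * y ^+ 2 <= t ^+ 2 * (u * v))%R by rewrite ler_wpM2l ?sqr_ge0.
  by lra.
by rewrite ler_sqr// nnegrE ?addr_ge0 ?mulr_ge0 ?sqr_ge0.
Qed.

End measure_densities.

(** * Conditional probabilities as densities with respect to the law of [Z] *)

Section conditional_densities.
Local Open Scope ereal_scope.
Context d (T : measurableType d) (R : realType) (P : probability T R).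

Section restricted_law.
Context d' (S : measurableType d') (E : set T) (mE : measurable E).
Context (Z : {mfun T >-> S}).

Definition restricted_law : set S -> \bar R := mpushforward (mrestr P mE) Z.

HB.instance Definition _ := Measure.on restricted_law.

Let restricted_law_fin : fin_num_fun restricted_law.
Proof.
move=> D mD; apply: (fin_num_measure P); apply: measurableI => //.
exact: measurable_funPTI.
Qed.

HB.instance Definition _ := Measure_isFinite.Build _ _ _ restricted_law
  restricted_law_fin.

End restricted_law.

Context d1 d2 d3 (S1 : measurableType d1) (S2 : measurableType d2)
  (S3 : measurableType d3).
Context (Y1 : {mfun T >-> S1}) (Y2 : {mfun T >-> S2}) (Z : {mfun T >-> S3}).

(** For measurable [E], [h \o Z] is a version of the conditional probability of [E] given [Z].
    Living on [S3], [h] can be compared with densities of other measures there. *)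
Definition cond_density (E : set T) (h : S3 -> R) :=
  [/\ (forall x, 0 <= h x)%R,
    (distribution P Z).-integrable [set: S3] (EFin \o h) &
    forall D, measurable D ->
      \int[distribution P Z]_(x in D) (h x)%:E = P (Z @^-1` D `&` E)].

Lemma cond_density_exists E : measurable E -> exists h, cond_density E h.
Proof.
move=> mE.
have [|h [h0 hi hE]] := @density_exists _ _ _ (distribution P Z)
  (restricted_law mE Z).
  apply/null_content_dominatesP => D mD ZD0.
  apply/eqP; rewrite eq_le measure_ge0 andbT -ZD0.
  by apply: le_measure; rewrite ?inE//; [apply: measurableI => //|];
    exact: measurable_funPTI.
by exists h; split.
Qed.

Lemma cond_density_is_cond_prob E h : measurable E -> cond_density E h ->
  is_cond_prob P Z E (h \o Z).
Proof.
move=> mE [h0 hi hE].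
have mh : measurable_fun [set: S3] h.
  exact/measurable_EFinP/measurable_int/hi.
have hZE D : measurable D ->
    \int[P]_(x in Z @^-1` D) (h (Z x))%:E = P (Z @^-1` D `&` E).
  move=> mD; rewrite -hE// ge0_integral_pushforward//.
  - by apply/measurable_EFinP; exact: measurable_funTS.
  - by move=> x _; rewrite lee_fin.
split.
- move=> _ Y mY; exists (h @^-1` Y) => //.
  by rewrite -[X in measurable X]setTI; exact: mh.
- apply/integrableP; split.
    by apply/measurable_EFinP; exact: measurableT_comp.
  under eq_integral do rewrite /= ger0_norm//.
  have := hZE _ measurableT; rewrite preimage_setT => ->.
  by rewrite setTI (le_lt_trans (probability_le1 P _)) ?ltry.
- by move=> _ [D mD <-]; rewrite setTI hZE// setIC.
Qed.

Lemma cond_density1 : cond_density [set: T] (cst 1%R).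
Proof.
split => [x||D mD]; first by rewrite /= ler01.
- exact: finite_measure_integrable_cst.
- by rewrite [LHS](integral_cst _ mD 1%:E) mul1e setIT.
Qed.

Lemma cond_density_ge E h (L : {finite_measure set S3 -> \bar R}) l (a : R) :
  cond_density E h -> (forall x, 0 <= l x)%R ->
  (distribution P Z).-integrable [set: S3] (EFin \o l) ->
  (forall D, measurable D -> \int[distribution P Z]_(x in D) (l x)%:E = L D) ->
  (0 <= a)%R -> (forall D, measurable D -> a%:E * L D <= P (Z @^-1` D `&` E)) ->
  {ae distribution P Z, forall x, (a * l x <= h x)%R}.
Proof.
move=> [h0 hi hE] l0 li lE a0 aL; apply: ae_le_of_integral_le => //.
  exact: (integrableZl measurableT a li).
have ml : measurable_fun [set: S3] l.
  exact/measurable_EFinP/measurable_int/li.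
move=> D mD; rewrite hE// (le_trans _ (aL _ mD))// -lE//.
under eq_integral do rewrite EFinM.
rewrite ge0_integralZl//.
- by apply/measurable_EFinP; exact: measurable_funTS.
- by move=> x _; rewrite lee_fin.
Qed.

Lemma cond_density_integralT E h : measurable E -> cond_density E h ->
  \int[distribution P Z]_x (h x)%:E = (fine (P E))%:E.
Proof.
move=> mE [_ _ hE]; rewrite hE// preimage_setT setTI fineK//.
exact: fin_num_measure.
Qed.

(** The bound with [a > 0] makes [L] absolutely continuous with respect to the law of [Z]. Its
    density [l] then satisfies [a * l <= p] and [b * l <= q] almost everywhere, and Cauchy-Schwarz
    applies. *)
Lemma cond_density_product_le (Ep Eq Er Es : set T) p q r s
    (L : {finite_measure set S3 -> \bar R}) (a b : R) :
  measurable Ep -> measurable Eq -> measurable Er -> measurable Es ->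
  cond_density Ep p -> cond_density Eq q ->
  cond_density Er r -> cond_density Es s ->
  {ae distribution P Z, forall x, (p x * q x = r x * s x)%R} ->
  (0 < a)%R -> (0 < b)%R ->
  (forall D, measurable D -> a%:E * L D <= P (Z @^-1` D `&` Ep)) ->
  (forall D, measurable D -> b%:E * L D <= P (Z @^-1` D `&` Eq)) ->
  (a * b * fine (L [set: S3]) ^+ 2 <= fine (P Er) * fine (P Es))%R.
Proof.
move=> mEp mEq mEr mEs hp hq hr hs pqrs a0 b0 aL bL.
have [|l [l0 li lE]] := @density_exists _ _ _ (distribution P Z) L.
  apply/null_content_dominatesP => D mD ZD0.
  have : a%:E * L D <= 0.
    rewrite (le_trans (aL _ mD))// -ZD0.
    by apply: le_measure; rewrite ?inE//; [apply: measurableI => //|];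
      exact: measurable_funPTI.
  move=> aLD; apply/eqP; rewrite eq_le measure_ge0 andbT.
  by move: aLD; rewrite pmule_rle0// lte_fin.
have [r0 ri _] := hr; have [s0 si _] := hs.
apply: (integral_sqr_le_of_product_eq _ _ _ r0 s0 l0 (ltW a0) (ltW b0) pqrs).
- exact/measurable_EFinP/measurable_int/ri.
- exact/measurable_EFinP/measurable_int/si.
- exact/measurable_EFinP/measurable_int/li.
- exact: (cond_density_ge hp l0 li lE (ltW a0) aL).
- exact: (cond_density_ge hq l0 li lE (ltW b0) bL).
- exact: cond_density_integralT.
- exact: cond_density_integralT.
- by rewrite lE// fineK// fin_num_measure.
Qed.

Lemma cond_independent_density E1 E2 :
  cond_independent P Y1 Y2 Z -> measurable E1 -> measurable E2 ->
  exists h h1 h2, [/\ cond_density (Y1 @^-1` E1 `&` Y2 @^-1` E2) h,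
    cond_density (Y1 @^-1` E1) h1, cond_density (Y2 @^-1` E2) h2 &
    {ae distribution P Z, forall x, (h x = h1 x * h2 x)%R}].
Proof.
move=> YZ mE1 mE2.
have mY1 : measurable (Y1 @^-1` E1) by exact: measurable_funPTI.
have mY2 : measurable (Y2 @^-1` E2) by exact: measurable_funPTI.
have [h hh] := cond_density_exists (measurableI _ _ mY1 mY2).
have [h1 hh1] := cond_density_exists mY1.
have [h2 hh2] := cond_density_exists mY2.
exists h, h1, h2; split => //.
have [N [mN N0 hN]] := YZ _ _ mE1 mE2 _ _ _
  (cond_density_is_cond_prob (measurableI _ _ mY1 mY2) hh)
  (cond_density_is_cond_prob mY1 hh1) (cond_density_is_cond_prob mY2 hh2).
have [_ hi _] := hh; have [_ h1i _] := hh1; have [_ h2i _] := hh2.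
have mh : measurable_fun [set: S3] h.
  exact/measurable_EFinP/measurable_int/hi.
have mh1 : measurable_fun [set: S3] h1.
  exact/measurable_EFinP/measurable_int/h1i.
have mh2 : measurable_fun [set: S3] h2.
  exact/measurable_EFinP/measurable_int/h2i.
(* The identity is known [P]-almost surely after composition with [Z]. The exceptional set in [S3]
   is measurable and its preimage under [Z] lies in the null set [N]. *)
pose M := ~` [set x | h x == h1 x * h2 x]%R.
have mM : measurable M.
  apply: measurableC; rewrite -[X in measurable X]setTI.
  by apply: measurable_fun_eqr => //; exact: measurable_funM.
exists M; split => //; last by move=> x /= hx /eqP.
apply/eqP; rewrite eq_le measure_ge0 andbT -N0.
apply: (@le_measure _ _ _ P (Z @^-1` M)); rewrite ?inE//.
  exact: measurable_funPTI.
by move=> x Mx; apply: hN => /eqP.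
Qed.

(* Both inequalities come from the single identity [h * 1 = h1 * h2] between
   conditional densities, read in the two directions. *)
Lemma cond_independent_joint_le E1 E2 (L : {finite_measure set S3 -> \bar R})
    (a b : R) :
  cond_independent P Y1 Y2 Z -> measurable E1 -> measurable E2 ->
  (0 < a)%R -> (0 < b)%R ->
  (forall D, measurable D ->
    a%:E * L D <= P (Z @^-1` D `&` (Y1 @^-1` E1 `&` Y2 @^-1` E2))) ->
  (forall D, measurable D -> b%:E * L D <= P (Z @^-1` D)) ->
  (a * b * fine (L [set: S3]) ^+ 2 <=
   fine (P (Y1 @^-1` E1)) * fine (P (Y2 @^-1` E2)))%R.
Proof.
move=> YZ mE1 mE2 a0 b0 aL bL.
have [h [h1 [h2 [hh hh1 hh2 hE]]]] := cond_independent_density YZ mE1 mE2.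
have mY1 : measurable (Y1 @^-1` E1) by exact: measurable_funPTI.
have mY2 : measurable (Y2 @^-1` E2) by exact: measurable_funPTI.
apply: (cond_density_product_le (measurableI _ _ mY1 mY2) measurableT mY1 mY2
  hh cond_density1 hh1 hh2 _ a0 b0 aL).
- by apply: filterS hE => x; rewrite mulr1.
- by move=> D mD; rewrite setIT; exact: bL.
Qed.

Lemma cond_independent_joint_ge E1 E2 (L : {finite_measure set S3 -> \bar R})
    (a b : R) :
  cond_independent P Y1 Y2 Z -> measurable E1 -> measurable E2 ->
  (0 < a)%R -> (0 < b)%R ->
  (forall D, measurable D -> a%:E * L D <= P (Z @^-1` D `&` Y1 @^-1` E1)) ->
  (forall D, measurable D -> b%:E * L D <= P (Z @^-1` D `&` Y2 @^-1` E2)) ->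
  (a * b * fine (L [set: S3]) ^+ 2 <=
   fine (P (Y1 @^-1` E1 `&` Y2 @^-1` E2)))%R.
Proof.
move=> YZ mE1 mE2 a0 b0 aL bL.
have [h [h1 [h2 [hh hh1 hh2 hE]]]] := cond_independent_density YZ mE1 mE2.
have mY1 : measurable (Y1 @^-1` E1) by exact: measurable_funPTI.
have mY2 : measurable (Y2 @^-1` E2) by exact: measurable_funPTI.
have -> : fine (P (Y1 @^-1` E1 `&` Y2 @^-1` E2)) =
    (fine (P (Y1 @^-1` E1 `&` Y2 @^-1` E2)) * fine (P [set: T]))%R.
  by rewrite probability_setT mulr1.
apply: (cond_density_product_le mY1 mY2 (measurableI _ _ mY1 mY2) measurableT
  hh1 hh2 hh cond_density1 _ a0 b0 aL bL).
by apply: filterS hE => x ->; rewrite mulr1.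
Qed.

End conditional_densities.

(** * Max-stability as bounds on probabilities *)

Section max_stability.
Context d (T : measurableType d) (R : realType) (P : probability T R).
Context (I : finType) (X : {RV P >-> vec R I}).

(** The reals have no least element to start the maximum from, so it starts from one of its own
    terms. *)
Definition cmax n (y : 'I_n.+1 -> vec R I) : vec R I :=
  fun i => \big[Num.max/y ord0 i]_(k < n.+1) y k i.

Definition vscale (c : R) (x : vec R I) : vec R I := fun i => c * x i.

Lemma measurable_vscale c : measurable_fun [set: vec R I] (vscale c).
Proof.
apply/measurable_vecP => i; apply: measurable_funM => //.
exact: measurable_coord.
Qed.

Lemma measurable_cmax d' (T' : measurableType d') n
    (Y : 'I_n.+1 -> {mfun T' >-> vec R I}) :
  measurable_fun [set: T'] (fun w => cmax (fun k => Y k w)).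
Proof.
apply/measurable_vecP => i; rewrite /cmax.
have mY k : measurable_fun [set: T'] (fun w => Y k w i).
  exact: (measurableT_comp (measurable_coord i)).
elim: (index_enum _) => [|k r IHr].
  under eq_fun do rewrite big_nil.
  exact: mY.
under eq_fun do rewrite big_cons; exact: (measurable_maxr (mY k) IHr).
Qed.

Section copies.
Hypothesis hX : simple_max_stable X.
Context (n : nat).
Local Open Scope ereal_scope.

Let prod_cst (x : \bar R) : x \is a fin_num ->
  \prod_(k < n) x = (fine x ^+ n)%:E.
Proof.
move=> xfin; elim: n => [|m IHm]; first by rewrite big_ord0.
by rewrite big_ord_recl IHm exprS EFinM fineK.
Qed.

(** The right-hand side is the probability that the maximum of [n + 1] independent copies lies in
    [H]. This event contains the one where copy 0 is in [G] and all others are in [V], whose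
    probability is the product on the left. *)
Lemma max_stable_ge (G V H : set (vec R I)) :
  measurable G -> measurable V -> measurable H ->
  (forall y : 'I_n.+1 -> vec R I, G (y ord0) ->
    (forall k, k != ord0 -> V (y k)) -> H (cmax y)) ->
  (fine (P (X @^-1` V)) ^+ n)%:E * P (X @^-1` G) <=
  P (X @^-1` (vscale n.+1%:R @^-1` H)).
Proof.
move=> mG mV mH GVH.
have [d' [T' [P' [Y [lawY indY lawmax]]]]] := hX.2 n.
pose E (k : 'I_n.+1) := if k == ord0 then G else V.
have mE k : measurable (E k) by rewrite /E; case: ifP.
have E0 : E ord0 = G by rewrite /E eqxx.
have ES k : E (lift ord0 k) = V by rewrite /E eq_sym (negPf (neq_lift _ _)).
have := indY E mE; rewrite (eq_bigr (fun k => P (X @^-1` E k))); last first.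
  by move=> k _; exact: lawY.
rewrite big_ord_recl E0 (eq_bigr (fun=> P (X @^-1` V))); last first.
  by move=> k _; rewrite ES.
rewrite prod_cst ?fin_num_measure//; last exact: measurable_funPTI.
rewrite muleC => <-; rewrite [leRHS](lawmax _ mH).
apply: le_measure; rewrite ?inE.
- by apply: fin_bigcap_measurable => // k _; exact: measurable_funPTI.
- by rewrite -[X in measurable X]setTI; exact: measurable_cmax.
- move=> w YE; apply: GVH => [|k k0].
    by have := YE ord0 Logic.I; rewrite /E eqxx.
  by have := YE k Logic.I; rewrite /E (negPf k0).
Qed.

(** Here the event on the maximum is contained in the event that all copies are in [V]. *)
Lemma max_stable_le (V H : set (vec R I)) : measurable V -> measurable H ->
  (forall y : 'I_n.+1 -> vec R I, H (cmax y) -> forall k, V (y k)) ->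
  P (X @^-1` (vscale n.+1%:R @^-1` H)) <= (fine (P (X @^-1` V)) ^+ n.+1)%:E.
Proof.
move=> mV mH HV.
have [d' [T' [P' [Y [lawY indY lawmax]]]]] := hX.2 n.
have := indY (fun=> V) (fun=> mV); rewrite (eq_bigr (fun k => P (X @^-1` V))).
  rewrite big_ord_recl prod_cst; last first.
    by apply: fin_num_measure; exact: measurable_funPTI.
  rewrite exprS EFinM fineK; last first.
    by apply: fin_num_measure; exact: measurable_funPTI.
  move=> <-; rewrite [leLHS](lawmax _ mH).
  apply: le_measure; rewrite ?inE.
  - by rewrite -[X in measurable X]setTI; exact: measurable_cmax.
  - by apply: fin_bigcap_measurable => // k _; exact: measurable_funPTI.
  - by move=> w Hw k _; exact: (HV (fun k => Y k w)).
by move=> k _; exact: lawY.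
Qed.

End copies.

End max_stability.

(** * Positive probability of boxes *)

Section positive_density.
Context (R : realType).

Import HBNNSimple.

(* The integrand is not assumed to be measurable. *)
Lemma cst_measure_le_integral d (T : measurableType d)
    (mu : {measure set T -> \bar R}) (f : T -> R) (D A : set T) (c : R) :
  measurable A -> A `<=` D -> 0 <= c -> (forall x, D x -> 0 <= f x) ->
  (forall x, A x -> c <= f x) ->
  (c%:E * mu A <= \int[mu]_(x in D) (f x)%:E)%E.
Proof.
move=> mA AD c0 f0 cf; rewrite ge0_integralE; last first.
  by move=> x /f0; rewrite lee_fin.
(* The integral is a supremum over simple functions below the integrand, and [c] times the indicator
   of [A] is one of them. *)
apply: ereal_sup_ubound; exists (scale_nnsfun (indic_nnsfun R mA) c0).
  move=> x; rewrite [leLHS](_ : _ = (c * \1_A x)%:E)// indicE patchE.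
  have [Ax|nAx] := boolP (x \in A).
    rewrite (mem_set (AD _ (set_mem Ax))) lee_fin mulr1 cf//.
    exact: set_mem.
  by rewrite mulr0; case: ifPn => // /set_mem Dx; rewrite lee_fin f0.
by rewrite /= sintegralrM sintegral_indic.
Qed.

Context (I : finType).

(** The product topology is a supremum of initial topologies, so it suffices that the filter
    generated by the cubes around [x] converges to [x] in each coordinate. *)
Lemma nbhs_vec_box (x : vec R I) (U : set (vec R I)) : nbhs x U ->
  exists2 e : R, 0 < e & forall y : vec R I,
    (forall i, `|x i - y i| < e) -> U y.
Proof.
pose G : set_system (vec R I) := filter_from [set e : R | 0 < e]
  (fun e => [set y : vec R I | forall i, `|x i - y i| < e]).
have FG : Filter G.
  apply: filter_from_filter; first by exists 1; exact: ltr01.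
  move=> e1 e2 e10 e20; exists (Num.min e1 e2).
    by rewrite /= lt_min e10 e20.
  by move=> y /= H; split=> i; have := H i; rewrite lt_min => /andP[].
suff Gx : G --> x by move=> /Gx[e e0 eU]; exists e.
apply/cvg_sup => i; apply/cvg_image.
  by rewrite eqEsubset; split=> v // _; exists (fun=> v).
move=> V /= /nbhs_ballP[e /= e0 eV]; exists (@^~ i @^-1` V).
  by exists e => // y /(_ i) ?; apply: eV.
by rewrite eqEsubset; split => [j [? + <-//]|j Vj]; exists (fun=> j).
Qed.

Lemma measurable_vec_box (J : finType) (A : J -> set R) :
  (forall j, measurable (A j)) ->
  measurable [set x : vec R J | forall j, A j (x j)].
Proof.
move=> mA; rewrite (_ : [set _ | _] =
    \bigcap_(j in [set: J]) (fun x : vec R J => x j) @^-1` A j).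
  apply: fin_bigcap_measurable => // j _.
  by rewrite -[X in measurable X]setTI; exact: measurable_coord.
by apply/seteqP; split=> x /= Ax j; [move=> _|]; exact: Ax.
Qed.

(** By continuity the density is at least half its value at the midpoint [x0] on a small box of
    positive volume. *)
Lemma positive_density_box_gt0 d (T : measurableType d) (P : probability T R)
    (X : {RV P >-> vec R I}) (lo hi : I -> R) :
  positive_continuous_density X -> (forall i, 0 <= lo i < hi i) ->
  (0 < P (X @^-1` [set x | forall i, (lo i < x i <= hi i)%R]))%E.
Proof.
move=> [f [f0 fc fP]] lohi.
pose x0 : vec R I := fun i => (lo i + hi i) / 2.
have x0pos : posvec x0.
  by move=> i; have /andP[? ?] := lohi i; rewrite /x0; lra.
have fx0 := f0 _ x0pos.
have fx0_half : f x0 / 2 < f x0 by lra.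
have : \forall y \near within (@posvec R I) (nbhs x0), f x0 / 2 < f y.
  have /subspace_continuousP/(_ _ x0pos) fx := fc.
  by apply: (fx [set t | f x0 / 2 < t]); exact: lt_nbhsr.
rewrite near_withinE => /nbhs_vec_box[e e0 Hf].
(* The small box extends from [x0] upwards only, so that its points exceed [lo] and are positive
   because [x0] is. *)
pose A i := `]x0 i, Num.min (x0 i + e) (hi i)[%classic.
have mA i : measurable (A i : set R) by exact: measurable_itv.
have x0A i : x0 i < Num.min (x0 i + e) (hi i).
  have /andP[? ?] := lohi i.
  by rewrite lt_min ltrDl e0 /=; rewrite /x0; lra.
have mbox : measurable [set x : vec R I | forall i, lo i < x i <= hi i].
  apply: (@measurable_vec_box I (fun i => `]lo i, hi i]%classic)) => i.
  exact: measurable_itv.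
rewrite fP//.
apply: (@lt_le_trans _ _
  ((f x0 / 2)%:E * lebesgue_vec [set x : vec R I | forall i, A i (x i)])%E).
  rewrite mule_gt0 ?lte_fin ?divr_gt0// lebesgue_vec_box//.
  apply: (big_ind (fun y : \bar R => 0 < y)%E) => //.
  - by move=> u v u0 v0; rewrite mule_gt0.
  - move=> i _; rewrite lebesgue_measure_itv/= lte_fin x0A.
    by rewrite -EFinB lte_fin subr_gt0.
apply: cst_measure_le_integral.
- exact: measurable_vec_box.
- move=> x Ax; split=> i; have := Ax i; rewrite /A /= in_itv/= lt_min;
    have /andP[? ?] := lohi i => /and3P[x0x _ xhi].
    by apply/andP; split; [move: x0x; rewrite /x0; lra|exact: ltW].
  by rewrite (lt_trans _ x0x).
- by rewrite divr_ge0// ltW.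
- by move=> x [_ /f0/ltW].
- move=> x Ax; apply/ltW/Hf.
    move=> i; have := Ax i; rewrite /A /= in_itv/= lt_min => /and3P[x0x xe _].
    by rewrite distrC ger0_norm ?subr_ge0 ?ltW// ltrBlDl.
  move=> i; have := Ax i; rewrite /A /= in_itv/= => /andP[+ _].
  exact: lt_trans.
Qed.

End positive_density.

(** * Distribution functions of subvectors *)

Section distribution_functions.
Context (R : realType) (I : finType).

HB.instance Definition _ (J : {set I}) := isMeasurableFun.Build _ _ _ _
  (@subvec R I J) (@measurable_subvec R I J).

HB.instance Definition _ (c : R) := isMeasurableFun.Build _ _ _ _
  (@vscale R I c) (@measurable_vscale R I c).

(** The threshold [a] is indexed by all of [I], so that one [a] serves every subset [J], including
    the empty one. *)
Definition below (J : {set I}) (a : I -> R) : set (vec R I) :=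
  [set x | forall i, i \in J -> x i <= a i].

Lemma measurable_below J a : measurable (below J a).
Proof.
apply: (@measurable_vec_box R I (fun i => [set t | i \in J -> t <= a i])) => i.
case: (i \in J).
  rewrite (_ : [set _ | _] = `]-oo, a i]%classic); first exact: measurable_itv.
  by apply/seteqP; split=> t /=; rewrite in_itv/=; [exact|move=> + _].
by rewrite (_ : [set _ | _] = setT)//; apply/seteqP; split.
Qed.

Lemma below0 a : below finset.set0 a = setT.
Proof. by apply/seteqP; split => // x _ i; rewrite finset.in_set0. Qed.

Lemma below_setU (J K : {set I}) a :
  below (J :|: K) a = below J a `&` below K a.
Proof.
apply/seteqP; split=> [x xJK|x [xJ xK] i].
  by split=> i iJ; apply: xJK; rewrite finset.in_setU iJ ?orbT.
by rewrite finset.in_setU => /orP[]; [exact: xJ|exact: xK].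
Qed.

Lemma cmax_below n (y : 'I_n.+1 -> vec R I) J a :
  below J a (cmax y) <-> forall k, below J a (y k).
Proof.
split=> [ya k i iJ|ya i iJ].
  by rewrite (le_trans _ (ya i iJ))//; exact: le_bigmax.
by apply: bigmax_le => [|k _]; exact: ya.
Qed.

Context d (T : measurableType d) (P : probability T R).
Context (X : {RV P >-> vec R I}).

Definition cdf_on J a : R := fine (P (X @^-1` below J a)).

Let mXbelow J a : measurable (X @^-1` below J a).
Proof. by apply: measurable_funPTI; exact: measurable_below. Qed.

Lemma cdf_onE J a : P (X @^-1` below J a) = (cdf_on J a)%:E.
Proof. by rewrite fineK// fin_num_measure. Qed.

Lemma cdf_on_ge0 J a : 0 <= cdf_on J a.
Proof. by rewrite fine_ge0. Qed.

Lemma cdf_on_gt0 J a : positive_continuous_density X -> (forall i, 0 < a i) ->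
  0 < cdf_on J a.
Proof.
move=> hd a0; rewrite -lte_fin -cdf_onE.
apply: lt_le_trans (positive_density_box_gt0 (lo := fun=> 0) (hi := a) hd _) _.
  by move=> i; rewrite lexx a0.
apply: le_measure; rewrite ?inE//.
  apply: measurable_funPTI.
  apply: (@measurable_vec_box R I (fun i => `]0, a i]%classic)) => i.
  exact: measurable_itv.
by move=> w Xw i _; have /andP[] := Xw i.
Qed.

(** Continuity from below: the events increase with [k], and their union imposes nothing on [C], as
    the finitely many coordinates are below some integer. *)
Lemma cdf_on_cvg (J C : {set I}) (a : I -> R) : [disjoint J & C]%B ->
  cdf_on (J :|: C) (fun i => if i \in C then k.+1%:R else a i)
    @[k --> \oo] --> cdf_on J a.
Proof.
move=> dJC.
pose F k := X @^-1` below (J :|: C) (fun i => if i \in C then k.+1%:R else a i).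
have FU : \bigcup_k F k = X @^-1` below J a.
  apply/seteqP; split=> [w [k _ Fk] i iJ|w wJ].
    by have := Fk i; rewrite finset.in_setU iJ (disjointFr dJC iJ); exact.
  exists (\max_i Num.truncn (X w i))%N => // i; rewrite finset.in_setU.
  case: ifPn => [_ _|_]; last by rewrite orbF; exact: wJ.
  apply/ltW/(lt_le_trans (truncnS_gt _)).
  by rewrite ler_nat ltnS; exact: leq_bigmax.
apply: fine_cvg; rewrite -cdf_onE -FU.
apply: nondecreasing_cvg_mu => [k||k l kl].
- exact: mXbelow.
- by rewrite FU.
apply/subsetPset => w Fk i iJC; have := Fk i iJC.
by case: ifP => // _ /le_trans; apply; rewrite ler_nat ltnS.
Qed.

End distribution_functions.

(** * Factorisation of the joint distribution function *)

Section conditional_independence.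
Context d (T : measurableType d) (R : realType) (P : probability T R).
Context (I : finType) (X : {RV P >-> vec R I}).
Hypotheses (hX : simple_max_stable X) (hdens : positive_continuous_density X).
Local Notation F := (cdf_on X).

Definition slab (C : {set I}) (a : I -> R) : set (vec R I) :=
  [set x | forall i, if i \in C then a i < x i else x i <= a i].

Section fixed_sample_size.
Context (C : {set I}) (a : I -> R) (n : nat).
Hypothesis a0 : forall i, 0 < a i.
Let N : R := n.+1%:R.

Let NK (x : vec R I) : vscale N^-1 (vscale N x) = x.
Proof. by apply/funext => i; rewrite /vscale mulKf// /N pnatr_eq0. Qed.

Let mslab : measurable (slab C a).
Proof.
apply: (@measurable_vec_box R I
  (fun i => [set t | if i \in C then a i < t else t <= a i])) => i.
case: (i \in C).
  rewrite (_ : [set _ | _] = `]a i, +oo[%classic); first exact: measurable_itv.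
  by apply/seteqP; split=> t /=; rewrite in_itv/= andbT.
rewrite (_ : [set _ | _] = `]-oo, a i]%classic); first exact: measurable_itv.
by apply/seteqP; split=> t /=; rewrite in_itv.
Qed.

Let mXslab : measurable (X @^-1` slab C a).
Proof. exact: measurable_funPTI. Qed.

(* [slab_law D] is the probability that [X] lies in [slab C a] and
   [X_C / (n + 1)] lies in [D]. *)
Definition slab_law : set (vec R {i | i \in C}) -> \bar R :=
  restricted_law P mXslab (subvec C \o (vscale N^-1 \o X)).

HB.instance Definition _ := FiniteMeasure.on slab_law.

Lemma slab_lawT : slab_law setT = P (X @^-1` slab C a).
Proof.
rewrite /slab_law /restricted_law /mpushforward /pushforward/= /mrestr.
by rewrite preimage_setT setTI.
Qed.

Lemma slab_gt0 : 0 < fine (P (X @^-1` slab C a)).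
Proof.
rewrite -lte_fin fineK; last exact: fin_num_measure.
(* The box with sides from [a i] to [a i + 1] on [C] and from 0 to [a i] elsewhere lies in the
   slab. *)
pose lo i := if i \in C then a i else 0.
pose hi i := if i \in C then a i + 1 else a i.
have lohi i : 0 <= lo i < hi i.
  by rewrite /lo /hi; case: ifP => _; have := a0 i; lra.
apply: lt_le_trans (positive_density_box_gt0 hdens lohi) _.
apply: le_measure; rewrite ?inE//.
  apply: measurable_funPTI.
  apply: (@measurable_vec_box R I (fun i => `]lo i, hi i]%classic)) => i.
  exact: measurable_itv.
move=> w Xw i; have := Xw i; rewrite /lo /hi; case: ifP => _ /andP[]//.
Qed.

(* One of the [n + 1] copies lies in [slab C a] and realises the maximum on [C],
   the others lie below [a]. *)
Lemma slab_law_le (J : {set I}) D : [disjoint J & C]%B -> measurable D ->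
  ((F (J :|: C) a ^+ n)%:E * slab_law D <=
   P ((subvec C \o X) @^-1` D `&` X @^-1` (vscale N @^-1` below J a)))%E.
Proof.
move=> dJC mD.
have mS : measurable_fun [set: vec R I] (subvec C \o vscale N^-1).
  exact: measurable_funP.
(* The maximum of the copies has the law of [N] times [X], so a condition on [X] becomes one on the
   maximum divided by [N]. *)
pose W := (subvec C \o vscale N^-1) @^-1` D.
have mW : measurable W by rewrite -[W]setTI; exact: mS.
have -> : slab_law D = P (X @^-1` (W `&` slab C a)) by [].
have := max_stable_ge hX (n := n) (measurableI _ _ mW mslab)
  (measurable_below (J :|: C) a) (measurableI _ _ mW (measurable_below J a)).
rewrite -/N; move=> /(_ _)/le_trans; apply; last first.
  rewrite le_eqVlt; apply/orP; left; apply/eqP; congr (P _).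
  apply/seteqP; split=> w.
    by rewrite /W /preimage /= NK.
  by rewrite /W /preimage /= NK.
move=> y [Wy0 sy0] yk; split; last first.
  apply/cmax_below => k; have [->|k0] := eqVneq k ord0.
    move=> i iJ; have := sy0 i; rewrite (disjointFr dJC iJ); exact.
  by have := yk k k0; rewrite below_setU => -[].
rewrite /W /preimage /=.
suff -> : subvec C (vscale N^-1 (cmax y)) =
  subvec C (vscale N^-1 (y ord0)) by [].
apply/funext => j; rewrite /subvec /vscale; congr (_ * _).
apply/eqP; rewrite eq_le; apply/andP; split; last exact: le_bigmax.
apply: bigmax_le => // k _; have [->//|k0] := eqVneq k ord0.
have jC := valP j; have := yk k k0.
rewrite below_setU => -[_ /(_ _ jC)] /le_trans.
by apply; have := sy0 (val j); rewrite jC => /ltW.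
Qed.

Lemma cdf_on_scale_le (J : {set I}) :
  fine (P (X @^-1` (vscale N @^-1` below J a))) <= F J a ^+ n.+1.
Proof.
have mJ := measurable_below J a.
rewrite -lee_fin fineK; last first.
  apply: fin_num_measure; apply: measurable_funPTI.
  by rewrite -[X in measurable X]setTI; exact: measurable_vscale.
apply: (max_stable_le hX mJ mJ) => y; exact: (cmax_below y J a).1.
Qed.

End fixed_sample_size.

Context (A B : {set I}).
Let C := ~: (A :|: B).
Hypothesis hcond : cond_independent P
  (fun w => subvec A (X w)) (fun w => subvec B (X w))
  (fun w => subvec C (X w)).

(** Conditional independence speaks of events of the subvectors, the max-stability bounds of events
    of the full vector; this translates between them. *)
Let below_subvec (J : {set I}) (c : R) (a : I -> R) :
  (subvec J \o X) @^-1` [set x | forall j, c * x j <= a (val j)] =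
  X @^-1` (vscale c @^-1` below J a).
Proof.
apply/seteqP; split=> [w wJ i iJ|w wJ j]; last exact: wJ (valP j).
exact: (wJ (exist _ i iJ)).
Qed.

Let measurable_below_subvec (J : {set I}) (c : R) (a : I -> R) :
  measurable [set x : vec R {i | i \in J} | forall j, c * x j <= a (val j)].
Proof.
apply: (@measurable_vec_box R {i | i \in J}
  (fun j => [set t | c * t <= a (val j)])) => j.
rewrite -[X in measurable X]setTI.
by apply: measurable_fun_ler => //; exact: measurable_funM.
Qed.

Let dC (J : {set I}) : J \subset A :|: B -> [disjoint J & C]%B.
Proof. by rewrite finset.disjoints_subset finset.setCK. Qed.

Let dA : [disjoint A & C]%B. Proof. by rewrite dC// finset.subsetUl. Qed.
Let dB : [disjoint B & C]%B. Proof. by rewrite dC// finset.subsetUr. Qed.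
Let dAB : [disjoint A :|: B & C]%B. Proof. exact: dC. Qed.
Let d0 : [disjoint (finset.set0 : {set I}) & C]%B.
Proof. by rewrite dC// finset.sub0set. Qed.

Section positive_threshold.
Context (a : I -> R).
Hypothesis a0 : forall i, 0 < a i.

(** This mass is positive and does not depend on [n], so its square disappears when [n] tends to
    infinity in [le_of_geometric_bound]. *)
Let q := fine (P (X @^-1` slab C a)).
Let q2_gt0 : 0 < q ^+ 2. Proof. by rewrite exprn_gt0// slab_gt0. Qed.

Let Fn_gt0 J n : 0 < F J a ^+ n. Proof. by rewrite exprn_gt0// cdf_on_gt0. Qed.

Let E n (J : {set I}) : set (vec R {i | i \in J}) :=
  [set x | forall j, n.+1%:R * x j <= a (val j)].

Let L n : {finite_measure set (vec R {i | i \in C}) -> \bar R} :=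
  slab_law (C := C) a n.

Let joint_event n :
  (subvec A \o X) @^-1` @E n A `&` (subvec B \o X) @^-1` @E n B =
  X @^-1` (vscale n.+1%:R @^-1` below (A :|: B) a).
Proof. by rewrite !below_subvec below_setU. Qed.

(** The law [slab_law] is compared with the joint event and with the sure event; Cauchy-Schwarz then
    bounds the product of the marginal probabilities from below. *)
Lemma cdf_on_joint_le :
  F (A :|: B :|: C) a * F C a <= F A a * F B a.
Proof.
apply: (le_of_geometric_bound q2_gt0) => [|n].
  by rewrite mulr_ge0 ?cdf_on_ge0.
rewrite 2!exprMn.
(* The bound on the unconstrained law of [X_C] is the case of empty [J] in [slab_law_le]. *)
have AB0 : F C a = F (finset.set0 :|: C) a by rewrite finset.set0U.

have scaleA := cdf_on_scale_le a n A.
have scaleB := cdf_on_scale_le a n B.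
apply: le_trans (ler_pM _ _ scaleA scaleB); rewrite ?fine_ge0//.
rewrite -!below_subvec /q -(slab_lawT C a n).
apply: (@cond_independent_joint_le _ _ _ _ _ _ _ _ _ _ (subvec A \o X)
  (subvec B \o X) (subvec C \o X) (@E n A) (@E n B) (L n) _ _ hcond) => //.
- exact: measurable_below_subvec.
- exact: measurable_below_subvec.
- by move=> D mD; rewrite joint_event; exact: slab_law_le.
- move=> D mD; rewrite AB0; apply: le_trans (slab_law_le a n d0 mD) _.
  by rewrite below0 preimage_setT preimage_setT setIT.
Qed.

(** The reverse reading: [slab_law] is compared with the two marginal events, and Cauchy-Schwarz
    bounds the joint probability from below. *)
Lemma cdf_on_joint_ge :
  F (A :|: C) a * F (B :|: C) a <= F (A :|: B) a.
Proof.
apply: (le_of_geometric_bound q2_gt0) => [|n]; first by rewrite cdf_on_ge0.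
rewrite exprMn.
apply: le_trans (cdf_on_scale_le a n (A :|: B)).
rewrite -joint_event /q -(slab_lawT C a n).
apply: (@cond_independent_joint_ge _ _ _ _ _ _ _ _ _ _ (subvec A \o X)
  (subvec B \o X) (subvec C \o X) (@E n A) (@E n B) (L n) _ _ hcond) => //.
- exact: measurable_below_subvec.
- exact: measurable_below_subvec.
- by move=> D mD; rewrite /E below_subvec; exact: slab_law_le.
- by move=> D mD; rewrite /E below_subvec; exact: slab_law_le.
Qed.

End positive_threshold.

Lemma cdf_on_independent (a : I -> R) : (forall i, 0 < a i) ->
  F (A :|: B) a = F A a * F B a.
Proof.
(* Raising the thresholds on [C] leaves [F A], [F B] and [F (A :|: B)] unchanged and removes [C]
   from the other terms in the limit. *)
move=> a0; pose b k i := if i \in C then k.+1%:R else a i.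
have b0 k i : 0 < b k i by rewrite /b; case: ifP.
have bJ k (J : {set I}) : [disjoint J & C]%B -> F J (b k) = F J a.
  move=> dJ; rewrite /cdf_on; congr (fine (P _)).
  by apply/seteqP; split=> w wJ i iJ; have := wJ i iJ;
    rewrite /b (disjointFr dJ iJ).
have cvgJ (J : {set I}) : [disjoint J & C]%B ->
    F (J :|: C) (b k) @[k --> \oo] --> F J a.
  exact: cdf_on_cvg.
have cvg0 : F C (b k) @[k --> \oo] --> (1 : R).
  have := cvgJ _ d0; rewrite finset.set0U.
  by rewrite /cdf_on below0 preimage_setT probability_setT.
apply/eqP; rewrite eq_le; apply/andP; split.
- rewrite -[leLHS]mulr1; apply: (cvgr_to_le (cvgM (cvgJ _ dAB) cvg0)).
  by apply: nearW => k; rewrite (le_trans (cdf_on_joint_le (b0 k)))// !bJ.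
- apply: (cvgr_to_le (cvgM (cvgJ _ dA) (cvgJ _ dB))).
  by apply: nearW => k; rewrite (le_trans (cdf_on_joint_ge (b0 k)))// !bJ.
Qed.

End conditional_independence.

(** * Orthants as a generating pi-system *)

Section orthants.
Context (R : realType) (J : finType).

Definition orthant (a : J -> R) : set (vec R J) :=
  [set x | forall j, x j <= a j].

Lemma measurable_orthant a : measurable (orthant a).
Proof.
apply: (@measurable_vec_box R J (fun j => [set t | t <= a j])) => j.
rewrite [X in measurable X](_ : _ = `]-oo, a j]%classic).
  exact: measurable_itv.
by apply/seteqP; split=> t /=; rewrite in_itv.
Qed.

Lemma orthant_setI a b :
  orthant a `&` orthant b = orthant (fun j => Num.min (a j) (b j)).
Proof.
apply/seteqP; split=> [x [xa xb] j|x xab].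
  by rewrite le_min xa xb.
by split=> j; have := xab j; rewrite le_min => /andP[].
Qed.

Lemma exhausting_orthants : \bigcup_k orthant (fun=> k%:R) = setT.
Proof.
apply/seteqP; split=> // x _.
exists (\max_j (Num.truncn (x j)).+1)%N => // j.
apply/ltW/(lt_le_trans (truncnS_gt _)); rewrite ler_nat.
exact: (leq_bigmax (F := fun j => (Num.truncn (x j)).+1)).
Qed.

Lemma measurable_vec_orthants :
  @measurable _ (vec R J) = <<s range orthant >>.
Proof.
apply/seteqP; split; last first.
  apply: smallest_sub; first exact: sigma_algebra_measurable.
  by move=> _ [a _ <-]; exact: measurable_orthant.
apply: smallest_sub; first exact: smallest_sigma_algebra.
move=> _ [j _ [Y mY <-]].
suff mj : measurable_fun setT
    ((fun x => x j) : g_sigma_algebraType (range orthant) -> R).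
  by rewrite setTI -[X in <<s _ >> X]setTI; exact: mj.
apply: (measurability (@RGenOInfty.G R)); first exact: RGenOInfty.measurableE.
move=> _ [_ [c ->] <-]; rewrite setTI -[X in measurable X]setCK.
apply: measurableC.
(* The half-space where coordinate [j] is at most [c] is a countable union of orthants whose other
   thresholds tend to infinity. *)
rewrite (_ : ~` _ =
  \bigcup_k orthant (fun i => if i == j then c else k%:R)).
  apply: bigcupT_measurable => k; apply: sub_sigma_algebra.
  by exists (fun i => if i == j then c else k%:R).
apply/seteqP; split=> x /=.
  rewrite in_itv/= andbT => /negP; rewrite -leNgt => xc.
  have : setT x by []; rewrite -exhausting_orthants => -[k _ xk].
  by exists k => // i; case: eqP => [->//|_]; exact: xk.
move=> [k _ /(_ j)]; rewrite eqxx in_itv/= andbT => xc.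
by apply/negP; rewrite -leNgt.
Qed.

(** With [E] fixed, both sides are finite measures in [D]. They agree on the orthants, which are
    stable under intersection, generate the sigma-algebra and exhaust the space. *)
Lemma independent_of_orthants d (T : measurableType d) (P : probability T R)
    (Y : {mfun T >-> vec R J}) (E : set T) : measurable E ->
  (forall a, P (Y @^-1` orthant a `&` E) = P (Y @^-1` orthant a) * P E)%E ->
  forall D, measurable D -> P (Y @^-1` D `&` E) = (P (Y @^-1` D) * P E)%E.
Proof.
move=> mE indE D mD.
have PE0 : 0 <= fine (P E) by rewrite fine_ge0.
pose m1 : {measure set (vec R J) -> \bar R} := restricted_law P mE Y.
pose m2 : {measure set (vec R J) -> \bar R} :=
  mscale (NngNum PE0) (distribution P Y).
have PEE : ((fine (P E))%:E = P E)%E by rewrite fineK// fin_num_measure.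
have m2E A : m2 A = (P (Y @^-1` A) * P E)%E by rewrite -PEE muleC.
rewrite -m2E; apply: (measure_unique (range orthant)
  (fun k => orthant (fun=> k%:R)) measurable_vec_orthants _ _ _ m1) => //.
- move=> _ _ [a _ <-] [b _ <-]; rewrite orthant_setI.
  by exists (fun j => Num.min (a j) (b j)).
- exact: exhausting_orthants.
- by move=> _ [a _ <-]; rewrite m2E; exact: indE.
- move=> k; rewrite (le_lt_trans (probability_le1 P _)) ?ltry//.
  apply: measurableI => //; apply: measurable_funPTI.
  exact: measurable_orthant.
Qed.

End orthants.

(** * From distribution functions to independence *)

Theorem theorem1 (R : realType) (d : measure_display) (T : measurableType d)
    (P : probability T R) (I : finType) (hI : (0 < #|I|)%N)
    (X : {RV P >-> vec R I})
    (hX : simple_max_stable X) (hdens : positive_continuous_density X)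
    (A B : {set I}) (hA : A != finset.set0) (hB : B != finset.set0)
    (hAB : [disjoint A & B]%B)
    (hcond : cond_independent P
       (fun w => subvec A (X w)) (fun w => subvec B (X w))
       (fun w => subvec (~: (A :|: B)) (X w))) :
  independent P (fun w => subvec A (X w)) (fun w => subvec B (X w)).
Proof.
(* [cdf_on_independent] covers positive thresholds. For an orthant with another threshold both sides
   of the product formula vanish, since the density charges positive vectors only. *)
have nonpos0 i t : t <= 0 -> P [set w | X w i <= t] = 0%E.
  move=> t0; have [f [_ _ fP]] := hdens.
  rewrite [LHS](fP [set x : vec R I | x i <= t]).
    rewrite (_ : _ `&` _ = set0) ?integral_set0//.
    apply/seteqP; split=> x //= [xt /(_ i)].
    by rewrite ltNge (le_trans xt t0).
  rewrite -[X in measurable X]setTI.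
  by apply: measurable_fun_ler => //; exact: measurable_coord.
have mpre (J : {set I}) E :
    measurable E -> measurable ((subvec J \o X) @^-1` E).
  exact: measurable_funPTI.
have orth (J : {set I}) (c : I -> R) (a : {i | i \in J} -> R) :
    (forall j, c (val j) = a j) ->
    (subvec J \o X) @^-1` orthant a = X @^-1` below J c.
  move=> ca; apply/seteqP; split=> [w wa i iJ|w wc j]; last first.
    by rewrite -ca; exact: wc (valP j).
  by have := wa (exist _ i iJ); rewrite -ca.
have null (J : {set I}) (a : {i | i \in J} -> R) j : a j <= 0 ->
    P ((subvec J \o X) @^-1` orthant a) = 0%E.
  move=> aj; apply/eqP; rewrite eq_le measure_ge0 andbT -(nonpos0 (val j) _ aj).
  apply: le_measure; rewrite ?inE.
  - by apply: mpre; exact: measurable_orthant.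
  - rewrite -[X in measurable X]setTI; apply: measurable_fun_ler => //.
    exact: (measurableT_comp (measurable_coord (val j))).
  - by move=> w /(_ j).
have indep_orthants a b :
  P ((subvec A \o X) @^-1` orthant a `&` (subvec B \o X) @^-1` orthant b) =
  (P ((subvec A \o X) @^-1` orthant a) *
   P ((subvec B \o X) @^-1` orthant b))%E.
  have [[j aj]|a_pos] := pselect (exists j, a j <= 0).
    rewrite (null _ _ _ aj) mul0e; apply/eqP; rewrite eq_le measure_ge0 andbT.
    rewrite -(null _ _ _ aj); apply: le_measure; rewrite ?inE.
    - by apply: measurableI; apply: mpre; exact: measurable_orthant.
    - by apply: mpre; exact: measurable_orthant.
    - exact: subIsetl.
  have [[j bj]|b_pos] := pselect (exists j, b j <= 0).
    rewrite (null _ _ _ bj) mule0; apply/eqP; rewrite eq_le measure_ge0 andbT.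
    rewrite -(null _ _ _ bj); apply: le_measure; rewrite ?inE.
    - by apply: measurableI; apply: mpre; exact: measurable_orthant.
    - by apply: mpre; exact: measurable_orthant.
    - exact: subIsetr.
  (* A single positive threshold on [I]: [a] on [A], [b] on [B] and 1 elsewhere. It agrees with [b]
     on [B] because [A] and [B] are disjoint. *)
  pose c i := oapp a (oapp b 1 (insub i)) (insub i).
  have c0 i : 0 < c i.
    rewrite /c; case: insubP => [k _ _|_] /=; case: insubP => [j _ _|_] //=;
      rewrite ltNge; apply/negP => le0.
    - by apply: a_pos; exists j.
    - by apply: b_pos; exists k.
    - by apply: a_pos; exists j.
  have cA j : c (val j) = a j by rewrite /c valK.
  have cB j : c (val j) = b j.
    have jA : (val j \in A) = false := disjointFl hAB (valP j).
    by rewrite /c valK /= insubF.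
  rewrite (orth A c a cA) (orth B c b cB) -preimage_setI -below_setU !cdf_onE.
  by rewrite -EFinM (cdf_on_independent hX hdens hcond c0).
move=> E1 E2 mE1 mE2.
(* Orthants are replaced by measurable sets one subvector at a time: first the set for [A] with the
   event of [B] fixed, then the set for [B] with an orthant for [A] fixed. *)
apply: (independent_of_orthants (Y := subvec A \o X)) => //.
  exact: (mpre B).
move=> a; rewrite setIC muleC.
apply: (independent_of_orthants (Y := subvec B \o X)) => //.
  by apply: mpre; exact: measurable_orthant.
by move=> b; rewrite setIC muleC; exact: indep_orthants.
Qed.
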